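(* Let $\lambda\in\mathbb{C}$ and let $n$ be a positive integer. Acting on functions of $x$, let $x$ denote the operator of multiplication by $x$ and $\delta_\lambda$ the shift operator $(\delta_\lambda f)(x)=f(x+\lambda)$. Then \[ e^{-(x+n\lambda)}(x\delta_\lambda)^n e^x=\langle x\rangle_{n,\lambda}=\sum_{k=0}^n{n \brack k}_\lambda x^k . \] In particular, evaluating at $x=1$, \[ e^{-(x+n\lambda)}(x\delta_\lambda)^n e^x\Big|_{x=1}=\sum_{k=0}^n{n \brack k}_\lambda=(n)_\lambda! . \]
   Context: For $\lambda\in\mathbb{C}$, the $\lambda$-rising factorial is $\langle x\rangle_{0,\lambda}=1$, $\langle x\rangle_{n,\lambda}=x(x+\lambda)\cdots(x+(n-1)\lambda)$ for $n\ge1$. The unsigned $\lambda$-Stirling numbers of the first kind are defined by $\langle x\rangle_{n,\lambda}=\sum_{k=0}^n {n \brack k}_\lambda x^k$. The $\lambda$-factorial is $(0)_\lambda!=1$ and $(n)_\lambda!=\langle 1\rangle_{n,\lambda}=\sum_{k=0}^n{n \brack k}_\lambda$ for $n\ge1$. The operators satisfy $\delta_\lambda x-x\delta_\lambda=\lambda\delta_\lambda$. *)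

(* Defs.v *)
From mathcomp Require Import all_boot all_order all_algebra.
From mathcomp Require Import complex.
From mathcomp Require Import reals topology normedtype sequences exp trigo.

Set Implicit Arguments.
Unset Strict Implicit.
Unset Printing Implicit Defensive.

Import GRing.Theory.
Local Open Scope ring_scope.
Local Open Scope complex_scope.

(* The libraries have no complex exponential:
   e^(a + ib) = e^a (cos b + i sin b). *)
Definition cexp {R : realType} (z : R[i]) : R[i] :=
  (expR (complex.Re z))%:C *
  (cos (complex.Im z) +i* sin (complex.Im z)).

(* <x>_{n,lambda} = x (x + lambda) ... (x + (n-1) lambda), in any commutative
   ring, so that it can also be formed with x the polynomial indeterminate. *)
Definition rising (A : comNzRingType) (lambda x : A) (n : nat) : A :=
  \prod_(i < n) (x + lambda *+ i).

(* Coefficient of x^k in the expansion of <x>_{n,lambda} as a polynomial. *)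
Definition stirling1 (A : comNzRingType) (lambda : A) (n k : nat) : A :=
  (rising lambda%:P 'X n)`_k.

Definition lfactorial (A : comNzRingType) (lambda : A) (n : nat) : A :=
  rising lambda 1 n.

Definition mulx {A : comNzRingType} (f : A -> A) : A -> A :=
  fun x => x * f x.

Definition delta_shift (A : comNzRingType) (lambda : A) (f : A -> A) : A -> A :=
  fun x => f (x + lambda).

(* Main.v *)
Require Import Defs.
From mathcomp Require Import all_boot all_order all_algebra.
From mathcomp Require Import complex.
From mathcomp Require Import reals.
From mathcomp Require Import exp trigo.

Import GRing.Theory.
Local Open Scope ring_scope.
Local Open Scope complex_scope.

(** Each shift moves the argument of everything to its right, so the multiplications by [x]
    accumulate into a rising factorial: for every function [f], the n-th power of the operator sends
    [f] to [rising lambda x n * f (x + lambda *+ n)] ([iter_mulx_delta_shift]). For [f = cexp] the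
    prefactor cancels the shifted exponential ([cexpN_mul]). The expansion in powers of [x] is
    evaluation of a polynomial of degree n ([horner_rising], [size_rising]). *)

Lemma cexpN_mul (R : realType) (z : R[i]) : cexp (- z) * cexp z = 1.
Proof.
(* The moduli are inverse and the phases conjugate, which leaves cos^2 + sin^2 = 1. *)
case: z => a b; rewrite /cexp /= cosN sinN mulrACA -rmorphM /= -expRD addNr expR0.
rewrite mul1r; apply/eqP; rewrite eq_complex /= mulNr opprK -!expr2 cos2Dsin2.
by rewrite mulNr [cos b * _]mulrC subrr !eqxx.
Qed.

(** Splitting off the first factor, not the last, matches the outermost operator of the
    iteration. *)
Lemma risingS (A : comNzRingType) (lambda x : A) (n : nat) :
  rising lambda x n.+1 = x * rising lambda (x + lambda) n.
Proof.
rewrite /rising big_ord_recl mulr0n addr0; congr (_ * _).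
by apply: eq_bigr => i _; rewrite /= mulrS addrA.
Qed.

Lemma iter_mulx_delta_shift (A : comNzRingType) (lambda : A) (f : A -> A) n x :
  iter n (mulx \o delta_shift lambda) f x
  = rising lambda x n * f (x + lambda *+ n).
Proof.
(* The point [x] stays general: the outer shift calls for the hypothesis at [x + lambda]. *)
elim: n x => [|n IHn] x; first by rewrite /rising big_ord0 mul1r addr0.
by rewrite iterS /= /mulx /delta_shift IHn risingS mulrA mulrS addrA.
Qed.

Lemma horner_rising (A : comNzRingType) (lambda x : A) (n : nat) :
  (rising lambda%:P 'X n).[x] = rising lambda x n.
Proof.
rewrite /rising horner_prod; apply: eq_bigr => i _.
by rewrite hornerD hornerX hornerMn hornerC.
Qed.

(** The factors are monic and linear, so the degree is exactly n even with zero divisors; this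
    bounds the sum at k = n. *)
Lemma size_rising (A : comNzRingType) (lambda : A) (n : nat) :
  size (rising lambda%:P 'X n) = n.+1.
Proof.
have -> : rising lambda%:P 'X n = \prod_(i < n) ('X - (- (lambda *+ i))%:P).
  by apply: eq_bigr => i _; rewrite polyCN opprK polyCMn.
by rewrite -big_enum size_prod_XsubC size_enum_ord.
Qed.

Lemma rising_stirling1 (A : comNzRingType) (lambda x : A) (n : nat) :
  rising lambda x n = \sum_(k < n.+1) stirling1 lambda n k * x ^+ k.
Proof. by rewrite -horner_rising horner_coef size_rising. Qed.

Theorem theorem6 (R : realType) (lambda : R[i]) (n : nat) (hn : (0 < n)%N) :
  (forall x : R[i],
      cexp (- (x + n%:R * lambda)) *
        iter n (mulx \o delta_shift lambda) cexp x
      = rising lambda x n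
   /\ rising lambda x n = \sum_(k < n.+1) stirling1 lambda n k * x ^+ k)
  /\
  (cexp (- (1 + n%:R * lambda)) *
     iter n (mulx \o delta_shift lambda) cexp 1
   = \sum_(k < n.+1) stirling1 lambda n k
   /\ \sum_(k < n.+1) stirling1 lambda n k = lfactorial lambda n).
Proof.
have rising_eq x : cexp (- (x + n%:R * lambda)) *
    iter n (mulx \o delta_shift lambda) cexp x = rising lambda x n.
  by rewrite iter_mulx_delta_shift mulr_natl mulrCA cexpN_mul mulr1.
have sum1 : \sum_(k < n.+1) stirling1 lambda n k = rising lambda 1 n.
  by rewrite rising_stirling1; apply: eq_bigr => k _; rewrite expr1n mulr1.
split; first by move=> x; split; [exact: rising_eq | exact: rising_stirling1].
by rewrite rising_eq sum1.
Qed.
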